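(* Let $R$ be a toric ring with $\mathrm{Cl}(R)\cong\mathbb{Z}^r$ and weights $\beta_1,\dots,\beta_n\in\mathbb{Z}^r$, and let $$\mathcal{W}(R)=\Big\{\sum_{i=1}^n a_i\beta_i : a_i\in[0,1)\Big\},\qquad \mathcal{W}'(R)=\Big\{\sum_{i=1}^n a_i\beta_i : a_i\in[0,1]\Big\}\subset\mathbb{R}^r.$$ Let $m\in\mathbb{Z}_{>0}$, let $p_i,q_i\in\mathbb{Z}_{>0}$ for $1\le i\le m$, and for $1\le i\le m$, $1\le j\le r$ let $c_{ij}$ be integers such that $\gcd(c_{i1},\dots,c_{ir})=1$ for every $i$. Suppose that $$\mathcal{C}=\Big\{z\in\mathbb{R}^r : -q_i\le\sum_{j=1}^r c_{ij}z_j\le p_i\ \text{ for } 1\le i\le m\Big\},\quad \mathcal{C}'=\Big\{z\in\mathbb{R}^r : -q_i-1\le\sum_{j=1}^r c_{ij}z_j\le p_i+1\ \text{ for } 1\le i\le m\Big\}$$ are convex polytopes. Then: (i) If $\mathcal{W}'(R)=\mathcal{C}'$, then $\mathcal{W}(R)\cap\mathbb{Z}^r=\mathcal{C}\cap\mathbb{Z}^r$. (ii) Suppose that $\mathcal{W}'(R)\subset\mathcal{C}'$. If all vertices of $\mathcal{C}'$ are in $\mathcal{W}'(R)$, then $\mathcal{W}'(R)=\mathcal{C}'$.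
   Context: $\Bbbk$ is an algebraically closed field of characteristic $0$. Toric ring: let $\tau\subset\mathbb{R}^d$ be a $d$-dimensional strongly convex rational polyhedral cone with minimal system of primitive generators $v_1,\dots,v_n\in\mathbb{Z}^d$, $\sigma_i(\mathbf x)=\langle\mathbf x,v_i\rangle$, $\sigma=(\sigma_1,\dots,\sigma_n)$, $\tau^\vee=\{\mathbf x\in\mathbb{R}^d:\sigma_i(\mathbf x)\ge 0\ \forall i\}$ and $R=\Bbbk[\tau^\vee\cap\mathbb{Z}^d]$. Then $\mathrm{Cl}(R)\cong\mathbb{Z}^n/\sigma(\mathbb{Z}^d)$, assumed isomorphic to $\mathbb{Z}^r$; fixing such an isomorphism, the weights are $\beta_1,\dots,\beta_n\in\mathbb{Z}^r$, where $\beta_i$ is the image of the $i$-th unit vector of $\mathbb{Z}^n$ (the class of the $i$-th torus-invariant prime divisor). *)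

(* Defs.v *)
From HB Require Import structures.
From mathcomp Require Import all_boot all_order all_algebra.
From mathcomp Require Import boolp classical_sets reals.

Set Implicit Arguments.
Unset Strict Implicit.
Unset Printing Implicit Defensive.

Import Order.TTheory GRing.Theory Num.Theory.

Local Open Scope classical_set_scope.
Local Open Scope ring_scope.

(** ** Vectors and polytopes *)

Definition toreal (R : realType) (r : nat) (w : 'rV[int]_r) : 'rV[R]_r :=
  map_mx intr w.

(* The lattice Z^r inside R^r. *)
Definition Zlattice (R : realType) (r : nat) : set 'rV[R]_r :=
  range (@toreal R r).
Arguments Zlattice R r _ : clear implicits.

(* The greatest common divisor of the entries; it is 0 when r = 0. *)
Definition gcd_entries (r : nat) (w : 'rV[int]_r) : nat :=
  \big[gcdn/0%N]_(j < r) `|w ord0 j|%N.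

Definition is_polytope (R : realType) (r : nat) (P : set 'rV[R]_r) : Prop :=
  exists (N : nat) (x : 'I_N -> 'rV[R]_r),
    P = [set z | exists a : 'I_N -> R,
           [/\ forall k, 0 <= a k, \sum_k a k = 1 & z = \sum_k a k *: x k]].

(* [z] is a vertex of [P] when [{z}] is a face of [P], i.e. the set of
   maximizers over [P] of some linear form [l]. *)
Definition is_vertex (R : realType) (r : nat) (P : set 'rV[R]_r)
    (z : 'rV[R]_r) : Prop :=
  exists l : 'rV[R]_r,
    [set y | P y /\ forall x, P x ->
       \sum_j l ord0 j * x ord0 j <= \sum_j l ord0 j * y ord0 j] = [set z].

(* [{z | lo_i <= \sum_j c_ij z_j <= hi_i for all i}] *)
Definition slabs (R : realType) (m r : nat) (c : 'M[int]_(m, r))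
    (lo hi : 'I_m -> R) : set 'rV[R]_r :=
  [set z | forall i : 'I_m,
     lo i <= \sum_(j < r) (c i j)%:~R * z ord0 j <= hi i].

(** ** Cones and toric rings *)

(* The map [x |-> (<x, v_1>, ..., <x, v_n>)], on Z^d for [F := int] and on
   R^d for [F := R]. *)
Definition sigma (F : comNzRingType) (d n : nat) (v : 'I_n -> 'rV[int]_d)
    (x : 'rV[F]_d) : 'rV[F]_n :=
  \row_i \sum_(j < d) x ord0 j * (v i ord0 j)%:~R.

(* The cone generated by the [v_i] with [i] in [J]. *)
Definition cone (R : realType) (d n : nat) (v : 'I_n -> 'rV[int]_d)
    (J : {set 'I_n}) : set 'rV[R]_d :=
  [set x | exists a : 'I_n -> R,
     (forall i, 0 <= a i) /\ x = \sum_(i in J) a i *: toreal R (v i)].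

(* The cone generated by all the [v_i] is [d]-dimensional and strongly convex,
   and the [v_i] form its minimal system of primitive generators.  Its
   dimension is that of its linear span, i.e. the rank of the [v_i]. *)
Record is_toric_cone (R : realType) (d n : nat) (v : 'I_n -> 'rV[int]_d)
    : Prop := {
  cone_full_dim : \rank (\matrix_i toreal R (v i)) = d;
  cone_strongly_convex : forall x : 'rV[R]_d,
    cone v [set: 'I_n] x -> cone v [set: 'I_n] (- x) -> x = 0;
  cone_primitive : forall i, gcd_entries (v i) = 1%N;
  cone_minimal : forall J : {set 'I_n},
    cone v J = cone v [set: 'I_n] :> set 'rV[R]_d -> J = [set: 'I_n]%SET
}.

Definition dual_cone (R : realType) (d n : nat) (v : 'I_n -> 'rV[int]_d)
    : set 'rV[R]_d :=
  [set x | forall i, 0 <= sigma v x ord0 i].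

(* [A] is, up to isomorphism, the semigroup algebra of the lattice points of
   the dual cone: it has a [k]-basis of monomials [chi u] indexed by these
   points and multiplied by adding exponents. *)
Definition is_toric_ring (R : realType) (k : fieldType) (A : comAlgType k)
    (d n : nat) (v : 'I_n -> 'rV[int]_d) : Prop :=
  let S := [set u : 'rV[int]_d | dual_cone v (toreal R u)] in
  exists chi : 'rV[int]_d -> A,
    [/\ chi 0 = 1,
        forall u w, S u -> S w -> chi (u + w) = chi u * chi w,
        forall f : A, exists (s : seq 'rV[int]_d) (a : 'rV[int]_d -> k),
          (forall u, u \in s -> S u) /\ f = \sum_(u <- s) a u *: chi u
      & forall (s : seq 'rV[int]_d) (a : 'rV[int]_d -> k),
          uniq s -> (forall u, u \in s -> S u) ->
          \sum_(u <- s) a u *: chi u = 0 -> forall u, u \in s -> a u = 0].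

(** ** The class group [Z^n / sigma(Z^d)] and the weights *)

Definition sigma_image (d n : nat) (v : 'I_n -> 'rV[int]_d)
    : {pred 'rV[int]_n} :=
  fun u => `[< exists x : 'rV[int]_d, u = sigma v x >].

Lemma sigma_image_zmod_closed (d n : nat) (v : 'I_n -> 'rV[int]_d) :
  zmod_closed (sigma_image v).
Proof.
split.
  apply/asboolP; exists 0; apply/rowP => i; rewrite !mxE big1 // => j _.
  by rewrite mxE mul0r.
move=> _ _ /asboolP[x ->] /asboolP[y ->]; apply/asboolP; exists (x - y).
apply/rowP => i; rewrite !mxE -sumrB; apply: eq_bigr => j _.
by rewrite !mxE mulrBl.
Qed.

HB.instance Definition _ (d n : nat) (v : 'I_n -> 'rV[int]_d) :=
  GRing.isZmodClosed.Build 'rV[int]_n (sigma_image v)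
    (sigma_image_zmod_closed v).

Definition Cl (d n : nat) (v : 'I_n -> 'rV[int]_d) : zmodType :=
  Quotient.quot (sigma_image v).

Definition weight (d n r : nat) (v : 'I_n -> 'rV[int]_d)
    (phi : {additive Cl v -> 'rV[int]_r}) (i : 'I_n) : 'rV[int]_r :=
  phi (\pi_(Quotient.quot (sigma_image v))%qT (delta_mx ord0 i)).

Definition W (R : realType) (n r : nat) (beta : 'I_n -> 'rV[int]_r)
    : set 'rV[R]_r :=
  [set z | exists a : 'I_n -> R,
     (forall i, 0 <= a i < 1) /\ z = \sum_i a i *: toreal R (beta i)].

Definition W' (R : realType) (n r : nat) (beta : 'I_n -> 'rV[int]_r)
    : set 'rV[R]_r :=
  [set z | exists a : 'I_n -> R,
     (forall i, 0 <= a i <= 1) /\ z = \sum_i a i *: toreal R (beta i)].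

Arguments W R {n r} beta _.
Arguments W' R {n r} beta _.

(* Main.v *)
Require Import Defs.
From mathcomp Require Import all_boot all_order all_algebra.
From mathcomp Require Import boolp classical_sets reals.
From mathcomp Require Import interval_inference convex.
From mathcomp Require Import ring lra.

Set Implicit Arguments.
Unset Strict Implicit.
Unset Printing Implicit Defensive.

Import Order.TTheory GRing.Theory Num.Theory.

Local Open Scope classical_set_scope.
Local Open Scope ring_scope.

(** For (i), a linear form with integer coefficients that is bounded by [M > 0]
    on [W'] is [< M] on [W], so its values at lattice points of [W] drop from
    [p i + 1] to [p i].  Conversely [C] lies well inside [C'] = [W']: for small
    [e > 0] the point [(1 + e) z] is still in [W'], and dividing its
    coefficients by [1 + e] makes them [< 1].

    For (ii), [W'] is convex, so it is enough that a polytope lies in every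
    convex set containing its vertices.  By Gordan's alternative, applied to the
    differences [x - y], each point [x] of a finite generating set is either
    exposed by a linear form or in the hull of the others; in the latter case it
    can be discarded. *)

(** * Linear forms and Gordan's alternative *)

Section Dot.
Variables (R : realFieldType) (r : nat).
Implicit Types (l u w : 'rV[R]_r) (a : R).

Definition dot l u : R := \sum_j l ord0 j * u ord0 j.

Lemma dotDl l u w : dot (l + u) w = dot l w + dot u w.
Proof.
by rewrite -big_split; apply: eq_bigr => j _ /=; rewrite !mxE mulrDl.
Qed.

Lemma dotZl a u w : dot (a *: u) w = a * dot u w.
Proof. by rewrite mulr_sumr; apply: eq_bigr => j _; rewrite !mxE mulrA. Qed.

Lemma dotDr l u w : dot l (u + w) = dot l u + dot l w.
Proof.
by rewrite -big_split; apply: eq_bigr => j _ /=; rewrite !mxE mulrDr.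
Qed.

Lemma dotZr a u w : dot u (a *: w) = a * dot u w.
Proof. by rewrite mulr_sumr; apply: eq_bigr => j _; rewrite !mxE mulrCA. Qed.

Lemma dot_gt0 u : u != 0 -> 0 < dot u u.
Proof.
move=> u0; have dot_ge0 : 0 <= dot u u.
  by apply: sumr_ge0 => j _; rewrite -expr2 sqr_ge0.
rewrite lt_def dot_ge0 andbT; apply: contra u0 => /eqP dot0.
apply/eqP/rowP => j; rewrite mxE; apply/eqP; rewrite -sqrf_eq0 expr2.
by rewrite (psumr_eq0P _ dot0) // => i _; rewrite -expr2 sqr_ge0.
Qed.

End Dot.

(* The origin need not belong to the cone. *)
Definition is_convex_cone (R : realFieldType) (r : nat) (K : set 'rV[R]_r) :=
  (forall u w, K u -> K w -> K (u + w)) /\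
  (forall a u, 0 < a -> K u -> K (a *: u)).

(** Induction on the number of vectors, eliminating one at a time. As a cone may omit the origin,
    the second case means that 0 is a nontrivial nonnegative combination of [s]. *)
Lemma gordan_alternative (R : realFieldType) (r : nat) (s : seq 'rV[R]_r) :
  (exists l, forall y, y \in s -> 0 < dot l y) \/
  (forall K, is_convex_cone K -> (forall y, y \in s -> K y) -> K 0).
Proof.
have [n] := ubnP (size s); elim: n s => // n IHn [|y s] /=.
  by left; exists 0.
rewrite ltnS => le_s_n.
have [->|y0] := eqVneq y 0.
  by right=> K _; apply; rewrite mem_head.
have [[l l_gt0]|K0] := IHn s le_s_n; last first.
  by right=> K cK Ks; apply: K0 => // z sz; apply: Ks; rewrite inE sz orbT.
have [ly_gt0|ly_le0] := ltP 0 (dot l y).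
  by left; exists l => z; rewrite inE => /predU1P[->//|/l_gt0].
(* Eliminating [y]: each [proj z] is in the cone of [y] and [z] and is
   orthogonal to [l]. *)
pose proj z := dot l z *: y + (- dot l y) *: z.
have [|[l' l'_gt0]|K0] := IHn (map proj s); first by rewrite size_map.
  (* The adjoint of [proj]: [dot l0 z] equals [dot l' (proj z)]. *)
  left; pose l0 := (- dot l y) *: l' + dot l' y *: l.
  have l0y : dot l0 y = 0 by rewrite dotDl !dotZl; ring.
  have l0_gt0 z : z \in s -> 0 < dot l0 z.
    move=> sz; have := l'_gt0 _ (map_f proj sz).
    by rewrite dotDr !dotZr dotDl !dotZl; lra.
  (* [T] is so large that adding [y] to [T *: l0] keeps it positive on [s], while its value at [y]
     becomes [dot y y]. *)
  pose T := 1 + \sum_(z <- s) `|dot y z| / dot l0 z.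
  exists (T *: l0 + y) => z; rewrite inE => /predU1P[->|sz].
    by rewrite dotDl dotZl l0y mulr0 add0r dot_gt0.
  have T_gt : `|dot y z| / dot l0 z < T.
    rewrite /T (big_rem z) //= -[ltLHS]add0r ltr_leD ?ltr01 //.
    rewrite lerDl big_seq sumr_ge0 // => x /mem_rem sx.
    by rewrite divr_ge0 // ltW // l0_gt0.
  rewrite dotDl dotZl; move: T_gt; rewrite ltr_pdivrMr ?l0_gt0 //.
  have := ler_norm (- dot y z); rewrite normrN; lra.
right=> K cK Ks; have [KD KZ] := cK; apply: K0 => // _ /mapP[z sz ->].
have Ky : K y by apply: Ks; rewrite mem_head.
have Kz : K z by apply: Ks; rewrite inE sz orbT.
(* If [dot l y] is 0, then [z] drops out of [proj z]; scaling by 0 is not allowed in [K]. *)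
have [ly0|ly_neq0] := eqVneq (dot l y) 0.
  by rewrite /proj ly0 oppr0 scale0r addr0; apply: KZ => //; apply: l_gt0.
apply: KD; apply: KZ => //; first exact: l_gt0.
by rewrite oppr_gt0 lt_neqAle ly_neq0.
Qed.

(** * Convex sets and hulls *)

Lemma convex_setP (R : numDomainType) (V : lmodType R)
    (D : set (convex_lmodType V)) :
  convex_set D <-> forall (a b : R) (u w : V), 0 < a -> 0 < b -> a + b = 1 ->
    D u -> D w -> D (a *: u + b *: w).
Proof.
split=> [/convex_setW convD a b u w a0 b0 ab Du Dw|convD].
  have bE : b = 1 - a by rewrite -ab addrAC subrr add0r.
  have a1 : a < 1 by rewrite -ab ltrDl.
  have a01 : Itv.spec (@Itv.num_sem R) (Itv.Real `[0%Z, 1%Z]) a.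
    by rewrite /= /Itv.num_sem /= in_itv /= (ltW a0) (ltW a1) gtr0_real.
  have := convD u w (mem_set Du) (mem_set Dw) (Itv.Def a01) a0 a1.
  by rewrite bE => /set_mem.
apply/convex_setW => u w /set_mem Du /set_mem Dw t t0 t1; apply/mem_set.
by apply: convD; rewrite ?subr_gt0 // addrC subrK.
Qed.

(** As an intersection of convex sets, the hull is handled by choosing [D], with no coefficients to
    carry. *)
Definition hull (R : realFieldType) (r : nat) (s : seq 'rV[R]_r) :
    set 'rV[R]_r :=
  [set z | forall D, convex_set D -> (forall x, x \in s -> D x) -> D z].

Lemma convex_mean (R : realFieldType) (r : nat) (D : set 'rV[R]_r) a b u w :
  convex_set D -> 0 < a -> 0 < b -> D u -> D w ->
  exists2 y, D y & a *: u + b *: w = (a + b) *: y.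
Proof.
move=> convD a0 b0 Du Dw; have ab0 : 0 < a + b by rewrite addr_gt0.
exists ((a / (a + b)) *: u + (b / (a + b)) *: w).
  by apply: (convex_setP D).1; rewrite ?divr_gt0 // -mulrDl divff ?gt_eqF.
by rewrite scalerDr !scalerA ![(a + b) * _]mulrC !divfK ?gt_eqF.
Qed.

Lemma convex_sum (R : realFieldType) (r N : nat) (D : set 'rV[R]_r)
    (x : 'I_N -> 'rV[R]_r) (a : 'I_N -> R) :
  convex_set D -> (forall i, D (x i)) -> (forall i, 0 <= a i) ->
  \sum_i a i = 1 -> D (\sum_i a i *: x i).
Proof.
move=> convD Dx a_ge0 sum_a.
case: N => [|N] in x a Dx a_ge0 sum_a *.
  by move: sum_a; rewrite big_ord0 => /esym/eqP; rewrite oner_eq0.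
(* Partial sums do not have total weight 1, so the invariant writes each as its weight times a point
   of [D]. *)
suff [_ [u Du]] : 0 <= \sum_i a i /\
    exists2 u, D u & \sum_i a i *: x i = (\sum_i a i) *: u.
  by rewrite sum_a scale1r => ->.
apply: (big_ind2 (fun y A => 0 <= A /\ exists2 u, D u & y = A *: u)).
- by split=> //; exists (x ord0); rewrite ?scale0r.
- move=> _ A1 _ A2 [A1_ge0 [u1 Du1 ->]] [A2_ge0 [u2 Du2 ->]].
  split; first exact: addr_ge0.
  have [->|A1_neq0] := eqVneq A1 0.
    by exists u2 => //; rewrite scale0r !add0r.
  have [->|A2_neq0] := eqVneq A2 0.
    by exists u1 => //; rewrite scale0r !addr0.
  have A1_gt0 : 0 < A1 by rewrite lt_def A1_neq0.
  have A2_gt0 : 0 < A2 by rewrite lt_def A2_neq0.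
  exact: convex_mean.
- by move=> i _; split=> //; exists (x i).
Qed.

Lemma polytope_hull (R : realType) (r : nat) (P : set 'rV[R]_r) :
  is_polytope P -> exists s, P = hull s.
Proof.
move=> [N [x ->]]; exists (codom x); apply/seteqP; split=> z.
  move=> [a [a_ge0 sum_a ->]] D convD Dx; apply: convex_sum => // i.
  by apply: Dx; rewrite codom_f.
(* The set of convex combinations is itself an admissible [D]. *)
apply.
  apply/convex_setP => a b _ _ a_gt0 b_gt0 ab
    [e [e_ge0 sum_e ->]] [f [f_ge0 sum_f ->]].
  exists (fun i => a * e i + b * f i); split.
  - by move=> i; rewrite addr_ge0 // mulr_ge0 // ltW.
  - by rewrite big_split -!mulr_sumr sum_e sum_f !mulr1.
  - rewrite !scaler_sumr -big_split; apply: eq_bigr => i _ /=.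
    by rewrite !scalerA scalerDl.
move=> _ /codomP[i ->]; exists (fun j => (j == i)%:R); split.
- by move=> j; rewrite ler0n.
- by rewrite (bigD1 i) //= eqxx big1 ?addr0 // => j /negPf->.
rewrite (bigD1 i) //= eqxx scale1r big1 ?addr0 // => j /negPf->.
exact: scale0r.
Qed.

(** * Polytopes are determined by their vertices *)

Lemma exposed_or_redundant (R : realFieldType) (r : nat) (x : 'rV[R]_r)
    (s : seq 'rV[R]_r) :
  (exists l, forall y, y \in s -> dot l y < dot l x) \/ hull s x.
Proof.
have [[l l_gt0]|K0] := gordan_alternative [seq x - y | y <- s]; [left|right].
  exists l => y sy; have := l_gt0 _ (map_f _ sy).
  by rewrite dotDr -scaleN1r dotZr; lra.
move=> D convD Ds.
(* The cone over [x - D]; it contains 0 only if [x] is in [D]. *)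
pose K := [set z | exists t u, [/\ 0 < t, D u & z = t *: (x - u)]].
have [] : K 0; last first.
  move=> t [u [t_gt0 Du /esym/eqP]].
  by rewrite scaler_eq0 gt_eqF //= subr_eq0 => /eqP->.
apply: K0 => [|_ /mapP[y sy ->]]; last first.
  by exists 1, y; rewrite scale1r; split=> //; apply: Ds.
split=> [_ _ [t [u [t0 Du ->]]] [t' [u' [t'0 Du' ->]]]|]; last first.
  move=> a _ a0 [t [u [t0 Du ->]]]; exists (a * t), u.
  by rewrite mulr_gt0 // scalerA.
have [y Dy yE] := convex_mean convD t0 t'0 Du Du'.
exists (t + t'), y; rewrite addr_gt0 //; split=> //.
by rewrite [RHS]scalerBr -yE scalerDl !scalerBr opprD addrACA.
Qed.

Lemma exposed_is_vertex (R : realType) (r : nat) (x l : 'rV[R]_r)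
    (s : seq 'rV[R]_r) :
  x \in s -> (forall y, y \in s -> y != x -> dot l y < dot l x) ->
  is_vertex (hull s) x.
Proof.
move=> sx l_lt; exists l.
(* The point [x] together with the open half-space below it is convex and contains [s], hence
   contains the hull. *)
have le_x y : hull s y -> y = x \/ dot l y < dot l x.
  move=> /(_ [set y | y = x \/ dot l y < dot l x]).
  apply=> [|z sz]; last first.
    by have [->|/l_lt-/(_ sz)] := eqVneq z x; [left|right].
  apply/convex_setP => a b u w a0 b0 ab.
  have lxE : dot l x = a * dot l x + b * dot l x by rewrite -mulrDl ab mul1r.
  rewrite /= dotDr !dotZr.
  move=> [->|lu] [->|lw]; first by left; rewrite -scalerDl ab scale1r.
  - by right; rewrite [ltRHS]lxE ltrD2l ltr_pM2l.
  - by right; rewrite [ltRHS]lxE ltrD2r ltr_pM2l.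
  - by right; rewrite [ltRHS]lxE ltrD // ltr_pM2l.
have hx : hull s x by move=> D _; apply.
apply/seteqP; split=> [y [hy /(_ x hx) le_xy]|_ ->].
  by case: (le_x y hy) => // lt_yx; move: lt_yx; rewrite ltNge le_xy.
by split=> // y /le_x[->//|/ltW].
Qed.

Lemma hull_sub_convex (R : realType) (r : nat) (s : seq 'rV[R]_r)
    (D : set 'rV[R]_r) :
  convex_set D -> (forall z, is_vertex (hull s) z -> D z) -> hull s `<=` D.
Proof.
move=> convD; have [n] := ubnP (size s); elim: n s => // n IHn s.
rewrite ltnS => le_s_n vertD.
have [[x sx hx]|irred] :=
    pselect (exists2 x, x \in s & hull [seq y <- s | y != x] x).
  (* Dropping all copies of a redundant [x] shortens the list but keeps the hull. *)
  have hE : hull s = hull [seq y <- s | y != x].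
    apply/seteqP; split=> z hz E convE Es; apply: hz => // y; last first.
      by rewrite mem_filter => /andP[_]; apply: Es.
    move=> sy; have [->|yx] := eqVneq y x; first exact: hx.
    by apply: Es; rewrite mem_filter yx.
  rewrite hE in vertD *; apply: IHn => //; apply: leq_trans le_s_n.
  rewrite size_filter -(count_predC (predC1 x)) -[ltnLHS]addn0 ltn_add2l.
  by rewrite -has_count; apply/hasP; exists x; rewrite //= eqxx.
(* Now no generator is redundant, so each one is exposed and thus a vertex. *)
move=> z; apply=> // x sx; apply: vertD.
have [[l l_lt]|hx] := exposed_or_redundant x [seq y <- s | y != x].
  apply: (@exposed_is_vertex _ _ _ l) => // y sy yx.
  by apply: l_lt; rewrite mem_filter yx.
by case: irred; exists x.
Qed.

(** * The zonotope [W'], its half-open version [W], and the two assertions *)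

Lemma W'_convex (R : realType) (n r : nat) (beta : 'I_n -> 'rV[int]_r) :
  convex_set (W' R beta).
Proof.
apply/convex_setP => a b _ _ a0 b0 ab [e [e01 ->]] [f [f01 ->]].
exists (fun i => a * e i + b * f i); split.
  move=> i; have /andP[e0 e1] := e01 i; have /andP[f0 f1] := f01 i.
  have [a_ge0 b_ge0] := (ltW a0, ltW b0).
  by rewrite addr_ge0 ?mulr_ge0 //= -ab lerD // ler_piMr.
rewrite !scaler_sumr -big_split; apply: eq_bigr => i _ /=.
by rewrite !scalerA scalerDl.
Qed.

Lemma dot_W_lt (R : realType) (n r : nat) (beta : 'I_n -> 'rV[int]_r)
    (l z : 'rV[R]_r) (M : R) :
  0 < M -> (forall y, W' R beta y -> dot l y <= M) -> W R beta z ->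
  dot l z < M.
Proof.
move=> M0 leM [a [a01 ->]].
have dot_sum (e : 'I_n -> R) : dot l (\sum_i e i *: toreal R (beta i)) =
    \sum_i e i * dot l (toreal R (beta i)).
  elim/big_ind2: _ => [|_ u _ w <- <-|i _]; last by rewrite dotZr.
    by rewrite -[X in dot _ X](scale0r 0) dotZr mul0r.
  by rewrite dotDr.
rewrite dot_sum; set f := fun i => dot l (toreal R (beta i)).
(* If some [f i] is positive, setting the coefficients to 1 exactly at the
   positive [f i] strictly increases the value, as [a i < 1]. *)
have [f_le0|/existsNP[i0 /negP]] := pselect (forall i, f i <= 0).
  apply: le_lt_trans _ M0; apply: sumr_le0 => i _.
  by apply: mulr_ge0_le0 (f_le0 i); case/andP: (a01 i).
rewrite -ltNge => f_gt0; pose e i : R := (0 < f i)%R%:R.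
apply: (@lt_le_trans _ _ (\sum_i e i * f i)); last first.
  rewrite -dot_sum; apply: leM; exists e; split=> // i.
  by rewrite ler0n lern1 leq_b1.
have le_ae i : a i * f i <= e i * f i.
  have /andP[a_ge0 /ltW a_le1] := a01 i; rewrite /e; case: ltP => fi.
    by rewrite ler_wpM2r // ltW.
  by rewrite mul0r mulr_ge0_le0.
rewrite [ltLHS](bigD1 i0) //= [ltRHS](bigD1 i0) //= ltr_leD ?ler_sum //.
by rewrite /e f_gt0 ltr_pM2r //; case/andP: (a01 i0).
Qed.

Theorem lemma3p2 (R : realType)
  (* the toric ring A over k, its class group and its weights *)
  (k : closedFieldType) (char_k : [pchar k] =i pred0)
  (d n r : nat) (v : 'I_n -> 'rV[int]_d) (v_cone : is_toric_cone R v)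
  (A : comAlgType k) (A_toric : is_toric_ring R A v)
  (phi : {additive Cl v -> 'rV[int]_r}) (phi_bij : bijective phi)
  (m : nat) (m_gt0 : (0 < m)%N)
  (p q : 'I_m -> nat)
  (p_gt0 : forall i, (0 < p i)%N) (q_gt0 : forall i, (0 < q i)%N)
  (c : 'M[int]_(m, r)) (gcd_c : forall i, gcd_entries (row i c) = 1%N) :
  let beta := weight phi in
  let C : set 'rV[R]_r :=
    slabs c (fun i => - (q i)%:R) (fun i => (p i)%:R) in
  let C' : set 'rV[R]_r :=
    slabs c (fun i => - (q i)%:R - 1) (fun i => (p i)%:R + 1) in
  is_polytope C -> is_polytope C' ->
  (W' R beta = C' -> W R beta `&` Zlattice R r = C `&` Zlattice R r)
  /\
  (W' R beta `<=` C' -> (forall z, is_vertex C' z -> W' R beta z) ->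
   W' R beta = C').
Proof.
move=> beta C C' _ polyC'; split=> [W'E|subC' vert]; last first.
  apply/seteqP; split=> //; have [s hE] := polytope_hull polyC'.
  by rewrite hE in vert *; apply: hull_sub_convex => //; apply: W'_convex.
have dotE i (z : 'rV[R]_r) :
    \sum_(j < r) (c i j)%:~R * z ord0 j = dot (toreal R (row i c)) z.
  by apply: eq_bigr => j _; rewrite !mxE.
have W'_C' y : W' R beta y -> forall i,
    - (q i)%:R - 1 <= dot (toreal R (row i c)) y <= (p i)%:R + 1.
  by rewrite W'E => C'y i; rewrite -dotE.
apply/seteqP; split=> z [zin zZ]; split=> //.
  case: zZ => w _ wz i; rewrite dotE.
  pose f : int := \sum_j c i j * w ord0 j.
  have fE : dot (toreal R (row i c)) z = f%:~R.
    rewrite -wz /dot rmorph_sum; apply: eq_bigr => j _.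
    by rewrite !mxE rmorphM.
  have lt_p : dot (toreal R (row i c)) z < (p i)%:R + 1.
    apply: dot_W_lt zin; first by rewrite ltr_wpDl.
    by move=> y /W'_C'/(_ i)/andP[].
  (* The lower bound is the upper bound for the opposite form. *)
  have lt_q : dot ((-1) *: toreal R (row i c)) z < (q i)%:R + 1.
    apply: dot_W_lt zin; first by rewrite ltr_wpDl.
    by move=> y /W'_C'/(_ i)/andP[? _]; rewrite dotZl; lra.
  rewrite dotZl fE in lt_q; rewrite fE in lt_p *.
  have {}lt_p : (f < (p i)%:Z + 1)%R by rewrite -(ltr_int R) rmorphD.
  have {}lt_q : (- (q i)%:Z - 1 < f)%R.
    by rewrite -(ltr_int R) rmorphB rmorphN /=; lra.
  have : - (q i)%:Z <= f <= (p i)%:Z.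
    by rewrite -[X in _ && X]ltzD1 lt_p -lezD1 subrK in lt_q *; rewrite lt_q.
  by rewrite -!(ler_int R) rmorphN.
(* On [C] each form is at most [p i + q i <= T] in absolute value, so scaling by [1 + T^-1] changes
   it by at most 1, the margin between [C] and [C']. *)
pose T : R := 1 + \sum_i ((p i)%:R + (q i)%:R).
have T_ge i : (p i)%:R + (q i)%:R <= T.
  by rewrite /T (bigD1 i) //= addrCA lerDl addr_ge0 // sumr_ge0.
have T0 : 0 < T by rewrite ltr_wpDr // sumr_ge0.
have T0i : 0 < T^-1 by rewrite invr_gt0.
have e_gt1 : 1 < 1 + T^-1 by rewrite ltrDl.
have : C' ((1 + T^-1) *: z).
  move=> i; have := zin i; rewrite !dotE dotZr => /andP[lo hi].
  have le1 : T^-1 * ((p i)%:R + (q i)%:R) <= 1.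
    by rewrite mulrC ler_pdivrMr // mul1r.
  have p0 : 0 <= T^-1 * (p i)%:R by rewrite mulr_ge0 // ltW.
  have q0 : 0 <= T^-1 * (q i)%:R by rewrite mulr_ge0 // ltW.
  have := ler_wpM2l (ltW T0i) lo; have := ler_wpM2l (ltW T0i) hi.
  by move=> *; apply/andP; split; lra.
rewrite -W'E => -[a [a01 eqz]]; exists (fun i => (1 + T^-1)^-1 * a i).
have e_gt0 : 0 < 1 + T^-1 by apply: lt_trans _ e_gt1.
split=> [i|].
  have /andP[a0 a1] := a01 i.
  rewrite mulr_ge0 ?invr_ge0 ?(ltW e_gt0) //= mulrC ltr_pdivrMr // mul1r.
  exact: le_lt_trans e_gt1.
under eq_bigr do rewrite -scalerA.
by rewrite -scaler_sumr -eqz scalerA mulVf ?scale1r // gt_eqF.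
Qed.
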